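(* Let $p>1$, let $G=(V,E)$ be a connected finite graph, and let $\lambda\in\mathbb{R}$ and $f:V\to\mathbb{R}$ satisfy $\lambda\int_V f\,d\mu<0$. Then there exists a function $u:V\to\mathbb{R}$ such that $$\Delta_p u(x)=\lambda e^{u(x)}\left(e^{u(x)}-1\right)+f(x)\quad\text{for all } x\in V.$$
   Context: A finite graph $G=(V,E)$ has a finite vertex set $V$ and a set $E$ of undirected edges (with unit weights and unit vertex measure); $y\sim x$ means $xy\in E$. For $p>1$ and $u:V\to\mathbb{R}$, the $p$-Laplacian is $$\Delta_p u(x)=\sum_{y\sim x}|u(y)-u(x)|^{p-2}(u(y)-u(x)),$$ where, when $1<p<2$, terms with $u(y)=u(x)$ are taken to be $0$. For $g:V\to\mathbb{R}$, $\int_V g\,d\mu=\sum_{x\in V}g(x)$. *)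

(* Defs.v *)
From HB Require Import structures.
From mathcomp Require Import all_boot all_order all_algebra.
From mathcomp Require Import all_classical all_reals all_analysis.
Set Implicit Arguments.
Unset Strict Implicit.
Unset Printing Implicit Defensive.
Import Order.TTheory GRing.Theory Num.Theory.
Local Open Scope ring_scope.

(* The edge relation is required to be symmetric but not irreflexive: a loop at
   x contributes 0 to the p-Laplacian and does not affect connectedness. *)
Definition connected_graph (V : finType) (e : rel V) : Prop :=
  symmetric e /\ forall x y : V, connect e x y.

(* A summand with u y = u x is 0 for every p, as it has the factor u y - u x
   and powR is total (0 `^ a = 0 for a != 0, including a < 0). *)
Definition p_laplacian (R : realType) (V : finType) (e : rel V) (p : R)
    (u : V -> R) (x : V) : R :=
  \sum_(y : V | e x y) `|u y - u x| `^ (p - 2) * (u y - u x).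

(* Main.v *)
(* Put h(t) = e^t (e^t - 1), H(t) = e^{2t}/2 - e^t (so H' = h) and
   c = - (sum f) / lambda, which is positive whatever the sign of lambda.
   Summing the equation over V shows that every solution lies on the level set
   M = {u | sum_x h(u x) = c}. On M the functional
     J(u) = 1/(2p) sum_{x, y ~ x} |u y - u x|^p + sum_x (lambda H(u x) + f x u x)
   attains its minimum: u is bounded above on M and positive somewhere, and by
   connectedness the p-energy controls the oscillation of u superlinearly.
   Every u + s delta_{x0} can be pushed back to M by adding a constant, smoothly
   in s. Hence at a minimiser the gradient K of J satisfies
   K x0 + tau * sum_x K x = 0 for some tau, and sum_x K x = 0 on M, so that the
   constraint leaves no Lagrange multiplier and K = 0 is the equation. *)

Require Import Defs.
From HB Require Import structures.
From mathcomp Require Import all_boot all_order all_algebra.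
From mathcomp Require Import all_classical all_reals all_analysis.
From mathcomp Require Import ring lra.
Set Implicit Arguments.
Unset Strict Implicit.
Unset Printing Implicit Defensive.
Import Order.TTheory GRing.Theory Num.Theory numFieldNormedType.Exports.
Local Open Scope ring_scope.

(** * Calculus of the power [|s| ^ p] *)

Lemma is_derive_fun_sum (R : realType) (I : Type) (r : seq I) (P : pred I)
    (h : I -> R -> R) (dh : I -> R) (t : R) :
  (forall i, P i -> is_derive t 1 (h i) (dh i)) ->
  is_derive t 1 (fun z => \sum_(i <- r | P i) h i z) (\sum_(i <- r | P i) dh i).
Proof.
move=> hP; elim: r => [|i r IH].
  rewrite (_ : (fun z => _) = cst 0) ?big_nil; first exact: is_derive_cst.
  by apply/funext => z; rewrite big_nil.
have [Pi|nPi] := boolP (P i); last first.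
  by under eq_fun do rewrite big_cons (negbTE nPi); rewrite big_cons (negbTE nPi).
under eq_fun do rewrite big_cons Pi; rewrite big_cons Pi.
exact: is_deriveD (hP i Pi) IH.
Qed.

Lemma powR_sub2_mul (R : realType) (p s : R) : 0 < s ->
  s `^ (p - 2) * s = s `^ (p - 1).
Proof.
move=> s0; have -> : p - 1 = p - 2 + 1 by ring.
by rewrite (powRD (r := p - 2)) ?(gt_eqF s0) ?implybT// powRr1 ?ltW.
Qed.

Lemma powR_invK (R : realType) (q a : R) : 0 < q -> 0 <= a ->
  (a `^ q^-1) `^ q = a.
Proof. by move=> q0 a0; rewrite -powRrM mulVf ?gt_eqF// powRr1. Qed.

(** Away from 0 the absolute value is locally [z] or [- z], and the chain rule applies. At 0 the
    difference quotient has absolute value [|h| ^ (p - 1)], which tends to 0 because [p > 1]; this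
    is where small [p] needs a separate argument. *)
Lemma is_derive_norm_powR (R : realType) (p s : R) : 1 < p ->
  is_derive s 1 (fun z : R => `|z| `^ p) (p * (`|s| `^ (p - 2) * s)).
Proof.
move=> p1; have p0 : 0 < p by lra.
have [s0|s0|->] := ltgtP s 0.
- apply: (@near_eq_is_derive _ _ _ ((fun z : R => z `^ p) \o -%R)).
    by near=> z; rewrite /= ltr0_norm//; near: z; exact: lt_nbhsl.
  have ns0 : 0 < - s by rewrite oppr_gt0.
  have := is_derive1_comp (is_derive1_powR p ns0) (is_deriveNid s 1).
  move=> /is_derive_eq; apply; rewrite ltr0_norm//.
  by rewrite -(powR_sub2_mul _ ns0); ring.
- apply: (@near_eq_is_derive _ _ _ (fun z : R => z `^ p)).
    by near=> z; rewrite /= gtr0_norm//; near: z; exact: lt_nbhsr.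
  have := is_derive1_powR p s0 => /is_derive_eq; apply.
  by rewrite gtr0_norm// powR_sub2_mul.
- rewrite !mulr0.
  have H : ((fun h : R => h^-1 *: (((fun z : R => `|z| `^ p) \o shift 0)
      (h *: (1 : R)) - `|0 : R| `^ p)) @ (0 : R)^' --> (0 : R))%classic.
    apply/cvgrPdist_lt => e e0.
    have q0 : 0 < p - 1 by lra.
    near=> h.
    have h0 : h != 0 by near: h; exact: nbhs_dnbhs_neq.
    rewrite sub0r normrN /= normr0 powR0 ?gt_eqF// subr0 addr0 /GRing.scale/= mulr1.
    have nh : 0 < `|h| by rewrite normr_gt0.
    rewrite normrM normfV norm_powR// normr_id.
    rewrite -(mulr_powRB1 (ltW nh) p0) mulKf ?gt_eqF//.
    rewrite -[ltRHS](powR_invK q0 (ltW e0)) gt0_ltr_powR//.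
      by rewrite nnegrE powR_ge0.
    near: h; apply: dnbhs0_lt; exact: powR_gt0.
  apply: DeriveDef; last exact: cvg_lim H.
  by apply/cvg_ex; exists 0.
Unshelve. all: by end_near. Qed.

Lemma continuous_norm_powR (R : realType) (p : R) : 1 < p ->
  continuous (fun z : R => `|z| `^ p).
Proof.
move=> p1 s; apply/differentiable_continuous/derivable1_diffP.
by have [] := is_derive_norm_powR s p1.
Qed.

(** Superlinearity in quantitative form, with an arbitrary slope [k]. Below the threshold
    [k ^ (1 / (p - 1))] the left side is nonpositive; above it [|s| ^ (p - 1)] is at least [k]. *)
Lemma norm_powR_ge_linear (R : realType) (p k s : R) : 1 < p -> 0 <= k ->
  k * `|s| - k * k `^ (p - 1)^-1 <= `|s| `^ p.
Proof.
move=> p1 k0; have q0 : 0 < p - 1 by lra.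
have p0 : 0 < p by lra.
have [hs|/ltW hs] := leP `|s| (k `^ (p - 1)^-1).
  by rewrite (le_trans _ (powR_ge0 _ _))// -mulrBr mulr_ge0_le0// subr_le0.
have kle : k <= `|s| `^ (p - 1).
  rewrite -[leLHS](powR_invK q0 k0).
  by rewrite ge0_ler_powR// ?nnegrE ?powR_ge0// ltW.
rewrite -(mulr_powRB1 (normr_ge0 s) p0) mulrC.
apply: (@le_trans _ _ (`|s| * k)); last exact: ler_wpM2l.
by rewrite gerBl mulr_ge0// powR_ge0.
Qed.

(** * Minimisation in the product topology on functions *)

Section ProductTopology.
Import ArrowAsProduct.

Lemma continuous_fun_sum (R : realType) (T : topologicalType) (I : Type)
    (r : seq I) (P : pred I) (h : I -> T -> R) :
  (forall i, P i -> continuous (h i)) ->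
  continuous (fun z => \sum_(i <- r | P i) h i z).
Proof.
move=> hP z; elim: r => [|i r IH].
  by under eq_fun do rewrite big_nil; exact: cst_continuous.
have [Pi|nPi] := boolP (P i); last first.
  by under eq_fun do rewrite big_cons (negbTE nPi).
under eq_fun do rewrite big_cons Pi.
exact: continuousD (hP i Pi z) IH.
Qed.

Lemma continuous_coord (R : realType) (V : finType) (x : V) :
  continuous ((fun u => u x) : (V -> R) -> R).
Proof. exact: (@proj_continuous V (fun=> R) x). Qed.

(** The box is a product of segments, hence compact by Tychonoff, and the level set of [G] is
    closed; [u0] makes their intersection nonempty. *)
Lemma box_attains_min (R : realType) (V : finType) (r c : R)
    (G J : (V -> R) -> R) (u0 : V -> R) :
  continuous G -> continuous J ->
  G u0 = c -> (forall x, `|u0 x| <= r) ->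
  exists u : V -> R, G u = c /\
    forall w, G w = c -> (forall x, `|w x| <= r) -> J u <= J w.
Proof.
move=> cG cJ Gu0 u0r.
pose A : set (V -> R) :=
  ([set u | forall x, `[-r, r]%classic (u x)] `&` (G @^-1` [set c]))%classic.
have memA w : G w = c -> (forall x, `|w x| <= r) -> A w.
  by move=> Gw wr; split=> // x; rewrite /= in_itv/= -ler_norml.
have cA : compact A.
  apply: compact_closedI.
    exact: (@tychonoff V (fun=> R) (fun=> `[-r, r]%classic)
              (fun=> @segment_compact R (-r) r)).
  by have /continuous_closedP := cG; apply; exact: closed_eq.
have [u uA umin] := compact_EVT_min (ex_intro _ u0 (memA _ Gu0 u0r)) cA
  (continuous_subspaceT cJ).
exists u; split; first by move: uA; rewrite inE => -[].
by move=> w Gw wr; apply: umin; rewrite inE; exact: memA.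
Qed.

End ProductTopology.

(** * The energy functional: Green formula, coercivity, derivative and continuity *)

Section Energy.
Variables (R : realType) (V : finType) (e : rel V) (p lambda : R) (f : V -> R).
Implicit Types u d : V -> R.
Import ArrowAsProduct.

Definition mass u : R := \sum_(x : V) expR (u x) * (expR (u x) - 1).

Definition total_variation u : R :=
  \sum_(x : V) \sum_(y : V | e x y) `|u y - u x|.

Definition energy u : R :=
  (2 * p)^-1 * \sum_(x : V) \sum_(y : V | e x y) `|u y - u x| `^ p
  + \sum_(x : V) (lambda * (expR (u x) ^+ 2 / 2 - expR (u x)) + f x * u x).

(** Discrete Green formula. Exchanging [x] and [y] in the half that carries [d y] flips the sign of
    the antisymmetric flux, so both halves agree; hence the factor -2. *)
Lemma sum_p_laplacian_mul u d : symmetric e ->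
  \sum_(x : V) \sum_(y : V | e x y)
     `|u y - u x| `^ (p - 2) * (u y - u x) * (d y - d x)
  = - 2 * \sum_(x : V) d x * p_laplacian e p u x.
Proof.
move=> esym.
under eq_bigr do under eq_bigr do rewrite mulrBr.
under eq_bigr do rewrite sumrB.
rewrite sumrB (exchange_big_dep xpredT)//= -sumrB mulr_sumr.
apply: eq_bigr => x _; rewrite /p_laplacian.
under eq_bigl do rewrite esym.
rewrite -sumrB mulrA mulr_sumr; apply: eq_bigr => y _.
by rewrite distrC; ring.
Qed.

Lemma sum_p_laplacian u : symmetric e -> \sum_(x : V) p_laplacian e p u x = 0.
Proof.
move=> esym; have := sum_p_laplacian_mul u (fun=> 1) esym.
under eq_bigr do under eq_bigr do rewrite subrr mulr0.
under eq_bigr do rewrite big1//.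
rewrite big1//; under eq_bigr do rewrite mul1r.
by lra.
Qed.

(** The difference telescopes along a path, each edge contributing at most the total variation.
    Shortening the path to one without repeated vertices bounds its length by [#|V|]. *)
Lemma dist_le_total_variation u x y : connect e x y ->
  `|u y - u x| <= #|V|%:R * total_variation u.
Proof.
have tv0 : 0 <= total_variation u by do 2 (apply: sumr_ge0 => ? _).
have edge a b : e a b -> `|u b - u a| <= total_variation u.
  move=> eab; rewrite /total_variation (bigD1 a)//= (bigD1 b)//=.
  by rewrite -addrA lerDl addr_ge0//; do ?(apply: sumr_ge0 => ? _).
have walk s a : path e a s ->
    `|u (last a s) - u a| <= (size s)%:R * total_variation u.
  elim: s a => [|b s IH] a /=; first by rewrite subrr normr0 mul0r.
  move=> /andP[eab /IH bs]; have := edge _ _ eab.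
  have := ler_normD (u (last b s) - u b) (u b - u a).
  by rewrite addrA subrK -natr1; lra.
move=> /connectP[s0 s0P ->]; case/shortenP: s0P => s sP /= /andP[_ us] _.
apply: le_trans (walk _ _ sP) _; rewrite ler_wpM2r// ler_nat.
by rewrite -(card_uniqP us) max_card.
Qed.

(** Each summand of the mass is at least -1, so the summand at [x] plus 1 is at most
    [mass u + #|V|]. With [E = expR (u x)] one has [E * (E - 1) + 1 >= E >= 1 + u x]. *)
Lemma mass_ub u x : u x <= mass u + #|V|%:R.
Proof.
have sq t : 0 <= t * (t - 1) + 1 :> R by have := sqr_ge0 (t - 2^-1); nra.
have : expR (u x) * (expR (u x) - 1) + 1 <= mass u + #|V|%:R.
  have -> : mass u + #|V|%:R = \sum_(y : V) (expR (u y) * (expR (u y) - 1) + 1).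
    by rewrite big_split/= sumr_const.
  by rewrite (bigD1 x)//= lerDl sumr_ge0// => y _; exact: sq.
have := expR_ge1Dx (u x); have := sqr_ge0 (expR (u x) - 1); nra.
Qed.

Lemma mass_gt0_coord u : 0 < mass u -> exists x, 0 < u x.
Proof.
move=> m0; apply: contrapT => /forallNP H; move: m0; apply/negP.
rewrite -leNgt; apply: sumr_le0 => x _.
rewrite pmulr_rle0 ?expR_gt0// subr_le0 -expR0 ler_expR leNgt.
exact/negP.
Qed.

Lemma energy_coercive (c E0 : R) :
  1 < p -> (forall x y, connect e x y) -> 0 < c ->
  exists r, forall u, mass u = c -> energy u <= E0 -> forall x, `|u x| <= r.
Proof.
move=> p1 econn c0.
pose N : R := #|V|%:R; pose C := c + N.
pose F : R := \sum_(x : V) `|f x|.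
pose M : R := `|lambda| * (expR C ^+ 2 / 2 + expR C).
(* The linear term [f x * u x] costs at most [F * N * T] up to constants, where [T] is the total
   variation. This [k] gives the edge energy slope [F * N + 1] in [T], so a full [T] survives and is
   bounded. *)
pose k := 2 * p * (F * N + 1).
pose K := \sum_(x : V) \sum_(y : V | e x y) k * k `^ (p - 1)^-1.
have N0 : 0 <= N by rewrite ler0n.
have F0 : 0 <= F by apply: sumr_ge0.
have k0 : 0 <= k by apply: mulr_ge0; [lra | rewrite addr_ge0 ?mulr_ge0].
exists (C + N * (E0 + (2 * p)^-1 * K + N * M + F * C)) => u mu Eu x.
set T := total_variation u.
have T0 : 0 <= T by do 2 (apply: sumr_ge0 => ? _).
have uC y : u y <= C by rewrite /C -mu mass_ub.
have [x0 ux0] : exists x0, 0 < u x0 by apply: mass_gt0_coord; rewrite mu.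
have C0 : 0 <= C by rewrite addr_ge0 // ltW.
(* The upper bound is [uC]; the lower one compares [u y] with the positive value [u x0]. *)
have uT y : `|u y| <= C + N * T.
  have := dist_le_total_variation u (econn x0 y); rewrite -/T -/N.
  have := uC y; have := mulr_ge0 N0 T0.
  by rewrite !ler_norml => ? ? /andP[? ?]; apply/andP; split; lra.
have edges : k * T - K <=
    \sum_(x : V) \sum_(y : V | e x y) `|u y - u x| `^ p.
  rewrite /T /K mulr_sumr -sumrB; apply: ler_sum => a _.
  rewrite mulr_sumr -sumrB; apply: ler_sum => b _.
  exact: norm_powR_ge_linear.
have vertices : - (N * M + F * (C + N * T)) <=
    \sum_(x : V) (lambda * (expR (u x) ^+ 2 / 2 - expR (u x)) + f x * u x).
  have -> : N * M + F * (C + N * T) = \sum_(y : V) (M + `|f y| * (C + N * T)).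
    by rewrite big_split/= sumr_const -mulr_suml mulr_natl.
  rewrite -sumrN.
  apply: ler_sum => y _; rewrite opprD lerD//.
    rewrite lerNl -mulNr (le_trans (ler_norm _))// normrM normrN ler_wpM2l//.
    have /andP[E1 E2] : 0 < expR (u y) <= expR C by rewrite expR_gt0 ler_expR uC.
    by rewrite ler_norml; apply/andP; split; nra.
  rewrite lerNl -mulNr (le_trans (ler_norm _))// normrM normrN.
  by rewrite ler_wpM2l.
have TE : T <= E0 + (2 * p)^-1 * K + N * M + F * C.
  have : (2 * p)^-1 * (k * T - K) <= E0 + N * M + F * (C + N * T).
    rewrite -addrA -lerBlDr; apply: le_trans Eu.
    by rewrite /energy lerD// ler_wpM2l// invr_ge0; lra.
  have -> : (2 * p)^-1 * (k * T - K) = (F * N + 1) * T - (2 * p)^-1 * K.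
    by rewrite /k; field; lra.
  by nra.
by rewrite (le_trans (uT x))// lerD2l ler_wpM2l.
Qed.

Lemma is_derive_energy (w : R -> V -> R) (t : R) d :
  1 < p -> symmetric e ->
  (forall x, is_derive t 1 (fun s => w s x) (d x)) ->
  is_derive t 1 (fun s => energy (w s))
    (\sum_(x : V) d x * (- p_laplacian e p (w t) x
       + lambda * expR (w t x) * (expR (w t x) - 1) + f x)).
Proof.
move=> p1 esym dw.
(* The new form is the one the chain rule produces. In the edge part, the factors [p] and -2 (Green
   formula) cancel [(2 * p)^-1] and leave [- p_laplacian]. *)
have -> : \sum_(x : V) d x * (- p_laplacian e p (w t) x
       + lambda * expR (w t x) * (expR (w t x) - 1) + f x)
  = (2 * p)^-1 * (\sum_(x : V) \sum_(y : V | e x y)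
       p * (`|w t y - w t x| `^ (p - 2) * (w t y - w t x)) * (d y - d x))
    + \sum_(x : V) (lambda * (expR (w t x) * d x * expR (w t x)
                              - expR (w t x) * d x) + f x * d x).
  under [in RHS]eq_bigr do under eq_bigr do rewrite -2!mulrA.
  under [in RHS]eq_bigr do under eq_bigr do rewrite [X in p * X]mulrA.
  under [in RHS]eq_bigr do rewrite -mulr_sumr.
  rewrite -mulr_sumr sum_p_laplacian_mul//.
  rewrite [X in X + _](_ : _ = \sum_x d x * - p_laplacian e p (w t) x).
    by rewrite -big_split/=; apply: eq_bigr => x _; ring.
  under [in RHS]eq_bigr do rewrite mulrN.
  by rewrite sumrN; field; lra.
apply: is_deriveD.
  apply: is_deriveZ.
  apply: is_derive_fun_sum => x _; apply: is_derive_fun_sum => y _.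
  exact: (is_derive1_comp (g := fun s => w s y - w s x)
    (is_derive_norm_powR (w t y - w t x) p1) (is_deriveB (dw y) (dw x))).
apply: is_derive_fun_sum => x _.
have dE := is_derive1_comp (is_derive_expR (w t x)) (dw x).
have dE2 : is_derive t 1 (fun s => expR (w s x) ^+ 2 / 2)
    (expR (w t x) * d x * expR (w t x)).
  rewrite (_ : (fun s => _) = 2^-1 *: ((expR \o w^~ x) * (expR \o w^~ x))).
    have := is_deriveZ 2^-1 (is_deriveM dE dE).
    by move=> /is_derive_eq; apply; rewrite /= /GRing.scale/=; field.
  by apply/funext => s; rewrite /= expr2 mulrC.
exact: (is_deriveD (is_deriveZ lambda (is_deriveB dE2 dE))
                   (is_deriveZ (f x) (dw x))).
Qed.

Lemma continuous_energy : 1 < p -> continuous (energy : (V -> R) -> R).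
Proof.
move=> p1.
have cE x : continuous ((fun u => expR (u x)) : (V -> R) -> R).
  by move=> u; exact: (continuous_comp (@continuous_coord R V x u)
    (@continuous_expR R (u x))).
have cs x y : continuous ((fun u => `|u y - u x| `^ p) : (V -> R) -> R).
  move=> u; have cxy : {for u, continuous (fun u : V -> R => u y - u x)}.
    exact: continuousB (@continuous_coord R V y u) (@continuous_coord R V x u).
  exact: (continuous_comp cxy (@continuous_norm_powR R p p1 _)).
move=> u; apply: (@continuousD R R (V -> R)).
  apply: (@continuousM R (V -> R) (fun=> _)); first exact: cst_continuous.
  by apply: continuous_fun_sum => x _; exact: continuous_fun_sum.
apply: continuous_fun_sum => x _ {}u.
apply: (@continuousD R R (V -> R)); last first.
  apply: (@continuousM R (V -> R) (fun=> _)); first exact: cst_continuous.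
  exact: continuous_coord.
apply: (@continuousM R (V -> R) (fun=> _)); first exact: cst_continuous.
apply: (@continuousB R R (V -> R)); last exact: cE.
apply: (@continuousM R (V -> R) _ (fun=> _)); last exact: cst_continuous.
exact: (@continuousM R (V -> R) _ _ u (@cE x u) (@cE x u)).
Qed.

Lemma continuous_mass : continuous (mass : (V -> R) -> R).
Proof.
apply: continuous_fun_sum => x _ u.
have cE : {for u, continuous (fun u : V -> R => expR (u x))}.
  exact: (continuous_comp (@continuous_coord R V x u)
    (@continuous_expR R (u x))).
apply: (@continuousM R (V -> R) _ _ u cE).
by apply: (@continuousB R R (V -> R)); [exact: cE | exact: cst_continuous].
Qed.

End Energy.

(** * Pushing a function back to the level set by a constant *)

Section Normalize.
Variables (R : realType) (V : finType).
Implicit Types u : V -> R.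

(* The positive root [a = exp s] of
   [a ^+ 2 * \sum_x expR (u x) ^+ 2 - a * \sum_x expR (u x) = c], so that
   [u + s] has mass [c]. *)
Definition mass_shift (c : R) u : R :=
  let A := \sum_x expR (u x) ^+ 2 in
  let B := \sum_x expR (u x) in
  ln ((B + Num.sqrt (B ^+ 2 + 4 * c * A)) / (2 * A)).

Lemma sum_gt0 (h : V -> R) (x0 : V) :
  (forall x, 0 < h x) -> 0 < \sum_x h x.
Proof.
by move=> h0; rewrite (bigD1 x0)//= ltr_pwDl// sumr_ge0// => x _; exact: ltW.
Qed.

Lemma mass_shiftP c u (x0 : V) : 0 < c ->
  mass (fun x => u x + mass_shift c u) = c.
Proof.
move=> c0; rewrite /mass_shift.
set A := \sum_x _ ^+ 2; set B := \sum_x expR _.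
have A0 : 0 < A by apply: sum_gt0 x0 _ => x; rewrite exprn_gt0 ?expR_gt0.
have B0 : 0 < B by apply: sum_gt0 x0 _ => x; rewrite expR_gt0.
set a := (_ / _).
have a0 : 0 < a by rewrite divr_gt0 ?ltr_pwDl ?sqrtr_ge0// mulr_gt0.
have aE : a ^+ 2 * A - a * B = c.
  have D0 : 0 <= B ^+ 2 + 4 * c * A.
    by have := mulr_gt0 c0 A0; have := sqr_ge0 B; nra.
  have := sqr_sqrtr D0; rewrite /a; set q := Num.sqrt _ => qE.
  (* Eliminating [c] in favour of the root [q] of the discriminant leaves a rational identity. *)
  have -> : c = (q ^+ 2 - B ^+ 2) / (4 * A).
    by rewrite qE; field; lra.
  by field; lra.
rewrite -[RHS]aE /A /B !mulr_sumr -sumrB; apply: eq_bigr => x _.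
by rewrite expRD lnK ?posrE//; ring.
Qed.

Lemma mass_shift_id c u (x0 : V) : 0 < c -> mass u = c -> mass_shift c u = 0.
Proof.
move=> c0 uc; rewrite /mass_shift.
set A := \sum_x _ ^+ 2; set B := \sum_x expR _.
have A0 : 0 < A by apply: sum_gt0 x0 _ => x; rewrite exprn_gt0 ?expR_gt0.
have B0 : 0 < B by apply: sum_gt0 x0 _ => x; rewrite expR_gt0.
have cE : c = A - B.
  by rewrite -uc /A /B -sumrB; apply: eq_bigr => x _; ring.
(* As [c = A - B], the discriminant is a perfect square, and [2 * A - B = A + c] is positive, so the
   root is [a = 1]. *)
rewrite (_ : B ^+ 2 + _ = (2 * A - B) ^+ 2); last by rewrite cE; ring.
rewrite sqrtr_sqr ger0_norm; last by lra.
by rewrite addrC subrK divff ?ln1// mulf_neq0// gt_eqF.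
Qed.

Lemma derivable_comp1 (g h : R -> R) (t : R) :
  derivable h t 1 -> derivable g (h t) 1 -> derivable (g \o h) t 1.
Proof.
by move=> /derivableP dh /derivableP dg; have [] := is_derive1_comp dg dh.
Qed.

(** The closed formula replaces an implicit function argument: the discriminant, the denominator and
    the argument of [ln] are all positive at [t]. *)
Lemma derivable_mass_shift (c t : R) (w : R -> V -> R) (x0 : V) : 0 < c ->
  (forall x, derivable (fun s => w s x) t 1) ->
  derivable (fun s => mass_shift c (w s)) t 1.
Proof.
move=> c0 dw.
pose A s := \sum_x expR (w s x) ^+ 2; pose B s := \sum_x expR (w s x).
have A0 : 0 < A t by apply: sum_gt0 x0 _ => x; rewrite exprn_gt0 ?expR_gt0.
have B0 : 0 < B t by apply: sum_gt0 x0 _ => x; rewrite expR_gt0.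
have dE x : derivable (fun s => expR (w s x)) t 1.
  by apply: (derivable_comp1 (dw x)); exact: derivable_expR.
have dA : derivable A t 1.
  apply: ex_derive; apply: is_derive_fun_sum => x _; apply: derivableP.
  rewrite (_ : (fun s => _) = (fun s => expR (w s x)) * (fun s => expR (w s x))).
    exact: derivableM.
  by apply/funext => s; rewrite expr2.
have dB : derivable B t 1.
  by apply: ex_derive; apply: is_derive_fun_sum => x _; apply: derivableP.
pose D s := B s ^+ 2 + 4 * c * A s.
have D0 : 0 < D t by rewrite /D; have := mulr_gt0 c0 A0; nra.
have dD : derivable D t 1.
  rewrite (_ : D = B * B + (4 * c) *: A); last first.
    by apply/funext => s; rewrite /D expr2.
  by apply: derivableD; [exact: derivableM | exact: derivableZ].
have dq : derivable (Num.sqrt \o D) t 1.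
  by apply: derivable_comp1 dD _; have [] := is_derive1_sqrt D0.
have dV : derivable (fun s => (2 * A s)^-1) t 1.
  apply: derivableV; first by rewrite mulf_neq0// gt_eqF.
  exact: (derivableZ (k := 2) dA).
apply: (@derivable_comp1 (@ln R)
  (fun s => (B s + Num.sqrt (D s)) * (2 * A s)^-1)).
  exact: derivableM (derivableD dB dq) dV.
have a0 : 0 < (B t + Num.sqrt (D t)) * (2 * A t)^-1.
  by rewrite divr_gt0 ?ltr_pwDl ?sqrtr_ge0// mulr_gt0.
by have [] := is_derive1_ln a0.
Qed.

End Normalize.

(** * Existence of a minimiser and its Euler-Lagrange equation *)

Theorem theorem1p3 (R : realType) (p : R) (hp : 1 < p)
    (V : finType) (e : rel V) (hG : connected_graph e)
    (lambda : R) (f : V -> R) (hf : lambda * (\sum_(x : V) f x) < 0) :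
  exists u : V -> R, forall x : V,
    p_laplacian e p u x = lambda * expR (u x) * (expR (u x) - 1) + f x.
Proof.
have [esym econn] := hG.
set S := \sum_(x : V) f x in hf.
have l0 : lambda != 0 by apply: contraTneq hf => ->; rewrite mul0r ltxx.
(* On an empty vertex set the hypothesis would read [0 < 0]. *)
have [z0 _|V0] := pickP (@predT V); last first.
  by move: hf; rewrite /S big_pred0 ?mulr0 ?ltxx.
pose c := - S / lambda.
have lc : lambda * c = - S by rewrite /c mulrC divfK.
have c0 : 0 < c.
  have : 0 < lambda ^+ 2 by rewrite exprn_even_gt0.
  by move=> l2; rewrite -(pmulr_rgt0 _ l2) expr2 -mulrA lc; lra.
pose J := energy e p lambda f.
have [u1 u1c] : exists u1 : V -> R, mass u1 = c.
  by eexists; exact: (mass_shiftP (fun=> 0) z0 c0).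
have [r rP] := energy_coercive lambda f (J u1) hp econn c0.
have [u [uc umin_box]] := box_attains_min (@continuous_mass R V)
  (@continuous_energy R V e p lambda f hp) u1c (rP u1 u1c (lexx _)).
(* From the box to the whole level set: if [J w <= J u1], coercivity puts [w] in the box; otherwise
   [u1], itself in the box, mediates. *)
have umin w : mass w = c -> J u <= J w.
  move=> wc; have [wle|/ltW] := leP (J w) (J u1).
    by apply: umin_box => //; exact: rP.
  by apply: le_trans; apply: umin_box => //; exact: (rP u1 u1c (lexx _)).
pose K x := - p_laplacian e p u x + lambda * expR (u x) * (expR (u x) - 1) + f x.
have sumK : \sum_x K x = 0.
  rewrite !big_split/= sumrN sum_p_laplacian// -/S.
  under eq_bigr do rewrite -mulrA.
  by rewrite -mulr_sumr -/(mass u) uc lc; ring.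
exists u => x0.
suff : K x0 = 0 by rewrite /K; lra.
pose v (s : R) x := u x + s * (x == x0)%:R.
pose w s x := v s x + mass_shift c (v s).
have w0 : w 0 = u.
  have v0 : v 0 = u by apply/funext => x; rewrite /v mul0r addr0.
  by apply/funext => x; rewrite /w v0 (mass_shift_id z0 c0 uc) addr0.
have dv (t : R) x : is_derive t 1 (fun s => v s x) (x == x0)%:R.
  have := is_deriveD (is_derive_cst (u x) t 1)
    (is_deriveM (is_derive_id t 1) (is_derive_cst ((x == x0)%:R : R) t 1)).
  by move=> /is_derive_eq; apply; rewrite /GRing.scale/= mulr0 !add0r mulr1.
have dshift (t : R) : derivable (fun s => mass_shift c (v s)) t 1.
  by apply: derivable_mass_shift z0 c0 _ => x; have [] := dv t x.
have dw (t : R) x : is_derive t 1 (fun s => w s x)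
    ((x == x0)%:R + 'D_1 (fun s => mass_shift c (v s)) t).
  exact: (is_deriveD (dv t x) (derivableP (dshift t))).
have dJ t := is_derive_energy lambda f hp esym (dw t).
(* The curve [w] stays on the level set and passes through [u] at 0, so 0 is an interior minimum;
   the interval from -1 to 1 is an arbitrary choice. *)
have dJ0 : is_derive (0 : R) 1 (fun s => J (w s)) 0.
  apply: (@derive1_at_min R _ (-1) 1).
  - by lra.
  - by move=> t _; have [] := dJ t.
  - by rewrite in_itv/=; lra.
  - by move=> t _; rewrite w0; apply: umin; exact: mass_shiftP.
have := @derive_val _ _ _ _ _ _ _ dJ0.
have [_ ->] := dJ 0; rewrite w0.
(* The velocity of [w] is the indicator of [x0] plus a constant, and the constant is multiplied by
   [\sum_x K x = 0]; only [K x0] remains. *)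
under eq_bigr do rewrite mulrDl.
rewrite big_split/= -mulr_sumr sumK mulr0 addr0 (bigD1 x0)//= eqxx mul1r.
by rewrite big1 ?addr0// => x /negbTE ->; rewrite mul0r.
Qed.
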